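(* For every covering pattern $M$ and all positive integers $b,m$, the matrix $A[b,m]$ is $M$-free. Hence for every covering pattern $M$, $\mathrm{Ex}(M,n)\ge n2^{\sqrt{\log n}-O(\log\log n)}$ as $n\to\infty$.
   Context: A pattern is a 0--1 matrix. A 0--1 matrix $A$ contains a pattern $P$ if $A$ can be transformed into $P$ by removing rows and columns from $A$ (keeping the order of the remaining ones) and changing some 1s to 0s; otherwise $A$ is $P$-free. $\mathrm{Ex}(P,n)$ is the maximum number of 1s in an $n\times n$ 0--1 matrix that is $P$-free. $\log$ is the binary logarithm. A pattern is acyclic if the bipartite graph whose vertices are its rows and columns and whose edges correspond to its 1s is a forest. Covering pattern. Let $M\in\{0,1\}^{\alpha\times\beta}$ be an acyclic pattern with rows indexed by $0\le i<\alpha$ and columns by $0\le j<\beta$. $M$ is a covering pattern if there is a distinguished row $k^*$ such that: (1) $M(k^*,0)=M(k^*,\beta-1)=1$. (2) Let $J$ be the set of row indices, excluding $k^*$, of rows with at least two 1s. $J$ contains at most one element $j_0<k^*$; if such an element $j_0$ exists, then some column contains two 1s in rows with indices in $[j_0,k^*]$. For every $j\in J$ with $j>k^*$, some column contains two 1s in rows with indices in $[k^*,j]$. (3) For $l\in J$ let $\mathrm{first}(l)$ and $\mathrm{last}(l)$ be the column indices of the first and last 1s in row $l$. Then the real intervals satisfy $\bigcup_{l\in J}[\mathrm{first}(l),\mathrm{last}(l)]=[0,\beta-1]$. The matrix $A[b,m]$. Let $[m]=\{1,\dots,m\}$. The rows of $A=A[b,m]$ are indexed by pairs $(s,r)\in[m]\times[m]^b$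 and its columns by pairs $(c,i)\in[m]^b\times\{0,1\}^b$, both ordered lexicographically. Its entries are $A((s,r),(c,i))=1$ if $r=c+s\cdot i$ (as integer vectors), and $0$ otherwise. *)

(* Defs.v *)
From mathcomp Require Import all_boot all_order all_algebra.
From mathcomp Require Import all_classical all_reals all_analysis.

Set Implicit Arguments.
Unset Strict Implicit.
Unset Printing Implicit Defensive.

Import Order.TTheory GRing.Theory Num.Theory.
Import numFieldNormedType.Exports.

Local Open Scope ring_scope.

(* [f] and [g] select the rows and columns of [A] that are kept. *)
Definition contains (m n a b : nat) (A : 'M[bool]_(m, n)) (P : 'M[bool]_(a, b))
    : Prop :=
  exists (f : 'I_a -> 'I_m) (g : 'I_b -> 'I_n),
    [/\ {homo f : i j / (i < j)%N}, {homo g : i j / (i < j)%N}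
      & forall i j, P i j -> A (f i) (g j)].

Definition pfree (m n a b : nat) (A : 'M[bool]_(m, n)) (P : 'M[bool]_(a, b))
    : Prop :=
  ~ contains A P.

Definition weight (m n : nat) (A : 'M[bool]_(m, n)) : nat :=
  #|[pred ij | A ij.1 ij.2]|.

Definition Ex (a b : nat) (P : 'M[bool]_(a, b)) (n : nat) : nat :=
  (\max_(A : 'M[bool]_n | `[< pfree A P >]) weight A)%N.

Definition bip_adj (a b : nat) (M : 'M[bool]_(a, b)) : rel ('I_a + 'I_b) :=
  fun u v => match u, v with
             | inl i, inr j => M i j
             | inr j, inl i => M i j
             | _, _ => false
             end.

(* A duplicate-free cyclic sequence of length at most 2 is not a graph cycle:
   length 2 corresponds to traversing a single edge back and forth. *)
Definition is_forest (V : finType) (e : rel V) : Prop :=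
  forall c : seq V, ucycle e c -> (size c <= 2)%N.

Definition acyclic (a b : nat) (M : 'M[bool]_(a, b)) : Prop :=
  is_forest (bip_adj M).

Section Covering.
Variables (R : realType) (a b : nat) (M : 'M[bool]_(a, b)).

Definition multirows (k : 'I_a) : pred 'I_a :=
  [pred l | (l != k) && (1 < #|[pred j | M l j]|)%N].

Definition column_pair (lo hi : 'I_a) : Prop :=
  exists j : 'I_b, (1 < #|[pred i : 'I_a | (lo <= i <= hi)%N && M i j]|)%N.

(* Only meaningful on rows having at least one 1. *)
Definition first_one (l : 'I_a) : nat := \big[minn/b]_(j < b | M l j) (j : nat).
Definition last_one (l : 'I_a) : nat := (\max_(j < b | M l j) j)%N.

Definition covering_row (k : 'I_a) : Prop :=
  [/\ (exists2 j : 'I_b, j = 0%N :> nat & M k j),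
      (exists2 j : 'I_b, j = b.-1 :> nat & M k j),
      ((#|[pred l in multirows k | (l < k)%N]| <= 1)%N
        /\ forall l, l \in multirows k -> (l < k)%N -> column_pair l k),
      (forall l, l \in multirows k -> (k < l)%N -> column_pair k l)
    & (\bigcup_(l in [set` multirows k])
         `[(first_one l)%:R : R, (last_one l)%:R]%classic
       = `[0, b%:R - 1]%classic)%classic].

Definition covering_pattern : Prop :=
  acyclic M /\ exists k : 'I_a, covering_row k.

End Covering.

Section Amatrix.
Variables b m : nat.

(* The element [x] of ['I_m] stands for the integer [x.+1] of {1, .., m}. *)
Definition Arow := ('I_m *l b.-tuplelexi 'I_m)%type.
Definition Acol := ((b.-tuplelexi 'I_m) *l (b.-tuplelexi bool))%type.

Definition Aentry (x : Arow) (y : Acol) : bool :=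
  [forall k : 'I_b,
     ((tnth x.2 k).+1 == (tnth y.1 k).+1 + x.1.+1 * tnth y.2 k)%N].

(* [Order.enum_val] enumerates a finite total order increasingly, here the
   lexicographic orders carried by [Arow] and [Acol]. *)
Definition Amx : 'M[bool]_(#|{: Arow}|, #|{: Acol}|) :=
  \matrix_(i, j) Aentry (Order.enum_val i) (Order.enum_val j).

End Amatrix.

Definition log2 (R : realType) (x : R) : R := ln x / ln 2.

(* Main.v *)
(* Suppose [M] embeds in [A[b,m]], and let row [k] go to slope [s].  The ones of
   row [k] in the first and last columns force [c] to increase by exactly [s] in
   the first coordinate [t] where the two end columns differ, and all columns in
   between share the prefix of [c] before [t], so [c_t] is monotone.  Within a
   row of slope [s'], [c_t] can only grow by [0] or [s'].  A row of [J] above [k]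
   (larger index) has [s' > s], hence no growth; the single possible row of [J]
   below [k] has [s' < s].  Since the intervals cover all columns, the total
   growth is less than [s], a contradiction.

   For the bound, keep the entries of [A[d,m]] with slope at most [m / 2d] and
   coordinates of [c] at most [m - m / 2d]; they number at least
   [m^(d+1) 2^d / 8d].  Choose [d] maximal with [2^(d(d+1)) <= n] and [m] maximal
   with [m^(d+1) <= n], so that [m >= 2^d] and [A[d,m]] fits in an [n x n] matrix. *)
Require Import Defs.
From mathcomp Require Import all_boot all_order all_algebra.
From mathcomp Require Import all_classical all_reals all_analysis.
From mathcomp Require Import zify lra.
Import Order.TTheory GRing.Theory Num.Theory.
Import numFieldNormedType.Exports.
Local Open Scope ring_scope.
Local Open Scope classical_set_scope.
Set Implicit Arguments.
Unset Strict Implicit.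
Unset Printing Implicit Defensive.

(** * Lexicographic order and the entries of [A] *)

(** If [y] left the common prefix of [x] and [z] before [t], it would exceed [x], hence also [z], at
    the first such place. *)
Lemma lexi_tuple_sandwich d (T : porderType d) (n : nat)
    (x y z : n.-tuplelexi T) (t : 'I_n) :
  (x <= y)%O -> (y <= z)%O ->
  (forall i : 'I_n, (i < t)%N -> tnth x i = tnth z i) ->
  [/\ forall i : 'I_n, (i < t)%N -> tnth x i = tnth y i,
      (tnth x t <= tnth y t)%O & (tnth y t <= tnth z t)%O].
Proof.
move=> /lexi_tupleP[k1 H1] /lexi_tupleP[k2 H2] xz.
have tk (k : 'I_n.+1) : (k < t)%N -> exists2 i : 'I_n, (i < t)%N & k = i :> nat.
  by move=> kt; exists (Ordinal (ltn_trans kt (ltn_ord t))).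
have k1t : (t <= k1)%N.
  rewrite leqNgt; apply/negP => /tk[i it ik].
  have lt1 : (tnth x i < tnth y i)%O.
    by rewrite (lt_leif (H1 _ _)) ?ik ?eqxx.
  case: (leqP i k2) => [/H2/leif_le le2|k2i].
    by have := lt_le_trans lt1 le2; rewrite (xz _ it) ltxx.
  have [j jt jk] := tk _ (ltn_trans k2i it).
  have lt2 : (tnth y j < tnth z j)%O.
    by rewrite (lt_leif (H2 _ _)) ?jk ?eqxx.
  have le1 : (tnth x j <= tnth y j)%O.
    by apply: leif_le (H1 j _); rewrite ik -jk ltnW.
  by have := le_lt_trans le1 lt2; rewrite (xz _ jt) ltxx.
have xy (i : 'I_n) : (i < t)%N -> tnth x i = tnth y i.
  move=> it; have ik := leq_trans it k1t.
  by have [_ /esym] := H1 i (ltnW ik); rewrite neq_ltn ik => /esym/eqP.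
have k2t : (t <= k2)%N.
  rewrite leqNgt; apply/negP => /tk[i it ik].
  have : (tnth y i < tnth z i)%O by rewrite (lt_leif (H2 _ _)) ?ik ?eqxx.
  by rewrite -xy // xz // ltxx.
by split=> //; [apply: leif_le (H1 t k1t) | apply: leif_le (H2 t k2t)].
Qed.

Lemma lt_Arow_fst b m (x y : Arow b m) : (x < y)%O -> (x.1 <= y.1)%N.
Proof. by case: x y => [x1 x2] [y1 y2]; rewrite ltxi_pair => /andP[]. Qed.

Lemma lt_Acol_fst b m (x y : Acol b m) : (x < y)%O -> (x.1 <= y.1)%O.
Proof. by case: x y => [x1 x2] [y1 y2]; rewrite ltxi_pair => /andP[]. Qed.

Lemma Aentry_tnth b m (x : Arow b m) (y : Acol b m) (k : 'I_b) :
  Aentry x y -> (tnth x.2 k = tnth y.1 k + x.1.+1 * tnth y.2 k :> nat)%N.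
Proof. by move=> /forallP/(_ k)/eqP; rewrite addSn => -[]. Qed.

Lemma Aentry_row_inj b m (x x' : Arow b m) (y : Acol b m) :
  Aentry x y -> Aentry x' y -> x.1 = x'.1 -> x = x'.
Proof.
case: x x' => [s r] [s' r'] xy xy' /= ss'; congr pair => //.
apply: eq_from_tnth => k; apply: val_inj => /=.
by have /= := Aentry_tnth k xy; have /= -> := Aentry_tnth k xy'; rewrite ss'.
Qed.

(** The slope [x.1.+1] is positive, so the differences between [x.2] and [y.1] determine the
    bits. *)
Lemma Aentry_col_inj b m (x : Arow b m) (y y' : Acol b m) :
  Aentry x y -> Aentry x y' -> y.1 = y'.1 -> y = y'.
Proof.
case: y y' => [c i] [c' i'] xy xy' /= cc'; congr pair => //.
apply: eq_from_tnth => k; have /= := Aentry_tnth k xy.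
have /= -> := Aentry_tnth k xy'; rewrite cc'.
by case: (tnth i k) (tnth i' k) => [] [] //=; lia.
Qed.

(** * Ones on both sides of a gap between columns *)

Section MultirowCover.
Variables (R : realType) (a b : nat) (M : 'M[bool]_(a, b)) (k : 'I_a).

(** The hypothesis [j < b] rules out the value [b] that [first_one] takes on a row without ones. *)
Lemma first_one_witness (l : 'I_a) (j : nat) :
  (first_one M l <= j)%N -> (j < b)%N -> exists2 p, M l p & (p <= j)%N.
Proof.
move=> lj jb; have [/exists_inP[p]|/exists_inPn noP] :=
  boolP [exists p in M l, (p <= j)%N]; first by exists p.
have : (j < first_one M l)%N.
  rewrite /first_one; elim/big_ind: _ => // [x y|p Mlp].
    by rewrite leq_min => -> ->.
  by rewrite ltnNge noP.
by rewrite ltnNge lj.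
Qed.

Lemma last_one_witness (l : 'I_a) (j : nat) :
  (j < last_one M l)%N -> exists2 p, M l p & (j < p)%N.
Proof.
move=> lj; have [/exists_inP[p]|/exists_inPn noP] :=
  boolP [exists p in M l, (j < p)%N]; first by exists p.
suff : (last_one M l <= j)%N by rewrite leqNgt lj.
by apply/bigmax_leqP => p /noP; rewrite -leqNgt.
Qed.

Hypothesis kP : covering_row R M k.

(* The midpoint of [j, j + 1] lies in one of the covering intervals, whose end
   points are integers. *)
Lemma multirow_cover (j : nat) : (j.+1 < b)%N ->
  exists l p q,
    [/\ l \in multirows M k, M l p, M l q, (p <= j)%N & (j < q)%N].
Proof.
move=> jb; have [_ _ _ _ cov] := kP.
have : `[0, b%:R - 1]%classic (j%:R + 2^-1 : R).
  rewrite /= in_itv /=; have : j.+2%:R <= b%:R :> R by rewrite ler_nat.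
  by rewrite -addn2 natrD => jbR; have := ler0n R j; lra.
rewrite -cov => -[l /= lJ]; rewrite in_itv /= => /andP[lo hi].
have lo' : (first_one M l <= j)%N.
  rewrite -ltnS -(ltr_nat R) -natr1; lra.
have hi' : (j < last_one M l)%N.
  rewrite -(ltr_nat R); lra.
have [p Mp pj] := first_one_witness lo' (ltnW jb).
have [q Mq jq] := last_one_witness hi'.
by exists l, p, q.
Qed.

End MultirowCover.

(** * Impossibility of embedding a covering pattern *)

Lemma multirow_nonempty a b (M : 'M[bool]_(a, b)) (k l : 'I_a) :
  l \in multirows M k -> exists j, M l j.
Proof. by rewrite inE => /andP[_ /ltnW/card_gt0P[j]]; exists j. Qed.

(** Monotonicity of [f] is asked only between rows containing ones, so that the lemma also serves
    for embeddings into a padded matrix. *)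
Lemma covering_row_not_embedded (R : realType) (a b : nat) (M : 'M[bool]_(a, b))
    (k : 'I_a) (d m : nat) (f : 'I_a -> Arow d m) (g : 'I_b -> Acol d m) :
  covering_row R M k ->
  (forall i i' j j', M i j -> M i' j' -> (i < i')%N -> (f i < f i')%O) ->
  (forall j j' : 'I_b, (j < j')%N -> (g j < g j')%O) ->
  (forall i j, M i j -> Aentry (f i) (g j)) -> False.
Proof.
move=> kP fmono gmono fgA.
have [[j0 j0E Mk0] [j1 j1E Mk1] [card_below below] above cover] := kP.
pose s i := (f i).1.+1.
have slope_mono i i' j j' : M i j -> M i' j' -> (i <= i')%N -> (s i <= s i')%N.
  rewrite leq_eqVlt => Mij Mij' /predU1P[/val_inj->|ii'] //.
  by rewrite ltnS lt_Arow_fst // (fmono _ _ _ _ Mij Mij').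
(* Slope and column determine the row, so two ones in one column have different slopes. *)
have slope_lt lo hi : (exists j, M lo j) -> (exists j, M hi j) ->
    column_pair M lo hi -> (s lo < s hi)%N.
  move=> [jl Ml] [jh Mh] [j /card_gt1P[x [y []]]].
  wlog xy : x y / (x < y)%N => [wl xP yP nxy|].
    have : (x != y :> nat) by [].
    by rewrite neq_ltn => /orP[] ?; [apply: (wl x y)|apply: (wl y x) => //; rewrite eq_sym].
  move=> /andP[/andP[lox _] Mx] /andP[/andP[_ yhi] My] _.
  apply: leq_ltn_trans (slope_mono _ _ _ _ Ml Mx lox) _.
  apply: leq_trans (slope_mono _ _ _ _ My Mh yhi).
  have fxy := fmono _ _ _ _ Mx My xy.
  rewrite ltn_neqAle ltnS (lt_Arow_fst fxy) andbT eqSS.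
  apply/eqP => /val_inj eq1.
  by have := Aentry_row_inj (fgA _ _ Mx) (fgA _ _ My) eq1 => fE; rewrite fE ltxx in fxy.
have c_mono (j j' : 'I_b) : (j <= j')%N -> ((g j).1 <= (g j').1)%O.
  by rewrite leq_eqVlt => /predU1P[/val_inj->|/gmono/lt_Acol_fst].
(* With a single column no row has two ones, and nothing would cover the point 0. *)
have b_gt1 : (1 < b)%N.
  rewrite ltnNge; apply/negP => b1.
  have b1E : b = 1%N by move: (ltn_ord j0) b1; lia.
  have : `[0, b%:R - 1]%classic (0 : R) by rewrite /= in_itv /= b1E subrr lexx.
  rewrite -cover => -[l /=]; rewrite inE => /andP[_] + _.
  apply/negP; rewrite -leqNgt; apply: leq_trans (max_card _) _.
  by rewrite card_ord.
have j01 : (j0 < j1)%N by lia.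
have c01 : ((g j0).1 < (g j1).1)%O.
  rewrite lt_neqAle c_mono ?(ltnW j01) // andbT; apply/eqP => c01.
  have gE := Aentry_col_inj (fgA _ _ Mk0) (fgA _ _ Mk1) c01.
  by have := gmono _ _ j01; rewrite gE ltxx.
have [t eq_t lt_t] := ltxi_tuplePlt c01.
pose phi j : nat := tnth (g j).1 t.
(* Both columns give the same [r_t = c_t + s i_t], so an increase of [c_t] means that the bit drops
   from 1 to 0. *)
have phi_ends : (phi j1 = phi j0 + s k)%N.
  have := Aentry_tnth t (fgA _ _ Mk0); have := Aentry_tnth t (fgA _ _ Mk1).
  move: lt_t; rewrite ltEord -/(phi j0) -/(phi j1) /s => lt_t.
  by case: (tnth (g j0).2 t) (tnth (g j1).2 t) => [] [] /=; nia.
have agree j (i : 'I_d) : (i < t)%N -> tnth (g j0).1 i = tnth (g j).1 i.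
  have j0j : (j0 <= j)%N by rewrite j0E.
  have jj1 : (j <= j1)%N by have := ltn_ord j; lia.
  by have [+ _ _] := lexi_tuple_sandwich (c_mono _ _ j0j) (c_mono _ _ jj1) eq_t; apply.
have phi_mono (j j' : 'I_b) : (j <= j')%N -> (phi j <= phi j')%N.
  move=> jj'; have [] // := lexi_tuple_sandwich (c_mono _ _ jj') (lexx _) (t := t).
  by move=> i it; rewrite -!agree.
have phi_jump l p q : M l p -> M l q -> (phi p < phi q)%N ->
    (phi q = phi p + s l)%N.
  move=> Mp Mq lt_pq; have := Aentry_tnth t (fgA _ _ Mp); have := Aentry_tnth t (fgA _ _ Mq).
  rewrite -/(phi p) -/(phi q) /s.
  by case: (tnth (g p).2 t) (tnth (g q).2 t) => [] [] /=; nia.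
have phi_range j : (phi j0 <= phi j <= phi j1)%N.
  by rewrite !phi_mono ?j0E //; have := ltn_ord j; lia.
(* A row whose interval contains a jump has smaller slope than [k], so it lies
   below [k], where there is at most one candidate. *)
have jump_below l p q : l \in multirows M k -> M l p -> M l q ->
    (phi p < phi q)%N -> (l < k)%N /\ (s l < s k)%N.
  move=> lJ Mp Mq lt_pq; have lne := multirow_nonempty lJ.
  have kne : exists j, M k j by exists j0.
  have := lJ; rewrite inE => /andP[lk _].
  have : (l != k :> nat) by [].
  rewrite neq_ltn => /orP[lt_lk|lt_kl].
    by split=> //; apply: slope_lt => //; apply: below.
  have := slope_lt _ _ kne lne (above _ lJ lt_kl).
  by have := phi_jump _ _ _ Mp Mq lt_pq; have := phi_range p; have := phi_range q; lia.
(* Extending [phi] to all naturals, with column [j0] as default, allows minimal indices to be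
   taken. *)
pose Phi n := phi (insubd j0 n).
have PhiE (j : 'I_b) : Phi j = phi j by rewrite /Phi valKd.
(* Two increases are singled out: the one leaving the initial value and, in [last_jump], the one
   reaching the final value. *)
have first_jump : exists2 n, (n.+1 < b)%N & (Phi n = phi j0 /\ phi j0 < Phi n.+1)%N.
  have ex : exists n, (n < b)%N && (phi j0 < Phi n)%N.
    by exists j1; rewrite ltn_ord PhiE phi_ends -[ltnLHS]addn0 ltn_add2l.
  case: (ex_minnP ex) => -[|n] /andP[nb lt_n] min_n.
    by move: lt_n; rewrite -j0E PhiE ltnn.
  exists n => //; split=> //; apply/eqP; rewrite eqn_leq.
  have /andP[-> _] := phi_range (insubd j0 n); rewrite andbT leqNgt.
  apply/negP => lt_n'; have := min_n n; rewrite (ltnW nb) lt_n' ltnn.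
  by move=> /(_ isT).
have last_jump : exists2 n, (n.+1 < b)%N & (Phi n.+1 = phi j1 /\ Phi n < phi j1)%N.
  have ex : exists n, (n < b)%N && (Phi n == phi j1).
    by exists j1; rewrite ltn_ord PhiE eqxx.
  case: (ex_minnP ex) => -[|n] /andP[nb /eqP eq_n] min_n.
    by move: eq_n; rewrite -j0E PhiE phi_ends /s; lia.
  exists n => //; split=> //; rewrite ltn_neqAle.
  have /andP[_ ->] := phi_range (insubd j0 n); rewrite andbT.
  apply/negP => lt_n'; have := min_n n; rewrite (ltnW nb) lt_n' ltnn.
  by move=> /(_ isT).
have Phi_mono n n' : (n <= n')%N -> (n' < b)%N -> (Phi n <= Phi n')%N.
  move=> nn' n'b; rewrite /Phi phi_mono // !val_insubd n'b.
  by rewrite (leq_ltn_trans nn' n'b).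
have [n nb [PhiN ltN]] := first_jump.
have [n' n'b [PhiN' ltN']] := last_jump.
have [l [p [q [lJ Mp Mq pn nq]]]] := multirow_cover kP nb.
have [l' [p' [q' [l'J Mp' Mq' p'n n'q']]]] := multirow_cover kP n'b.
have phip : phi p = phi j0.
  have := Phi_mono _ _ pn (ltnW nb); rewrite PhiE PhiN.
  by have := phi_range p; lia.
have phiq' : phi q' = phi j1.
  have := Phi_mono _ _ n'q' (ltn_ord _); rewrite PhiE PhiN'.
  by have := phi_range q'; lia.
have [lk slk] : (l < k)%N /\ (s l < s k)%N.
  apply: (jump_below _ p q) => //; rewrite phip (leq_trans ltN) //.
  by rewrite -PhiE Phi_mono.
have [l'k _] : (l' < k)%N /\ (s l' < s k)%N.
  apply: (jump_below _ p' q') => //; rewrite phiq' (leq_ltn_trans _ ltN') //.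
  by rewrite -PhiE Phi_mono // ltnW.
(* One row thus spans both increases: along it [phi] grows by the full [s k], while [phi_jump] gives
   [s l < s k]. *)
have ll' : l = l'.
  by apply: (card_le1_eqP card_below); rewrite inE ?lJ ?l'J.
rewrite -{}ll' in Mq'.
have := phi_jump _ _ _ Mp Mq'; rewrite phip phiq' phi_ends /s.
by move: slk; rewrite /s; lia.
Qed.

(** * Padding and freeness *)

Definition pad_mx (n p q : nat) (A : 'M[bool]_(p, q)) : 'M[bool]_n :=
  \matrix_(x, y) if insub (val x) is Some i
                 then if insub (val y) is Some j then A i j else false
                 else false.

Lemma pad_mxP (n p q : nat) (A : 'M[bool]_(p, q)) (x y : 'I_n) :
  reflect (exists (i : 'I_p) (j : 'I_q), [/\ x = i :> nat, y = j :> nat & A i j])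
          (pad_mx n A x y).
Proof.
rewrite mxE; apply: (iffP idP) => [|[i [j [xi yj Aij]]]]; last by rewrite /= xi yj !valK.
by case: insubP => // i _ xi; case: insubP => // j _ yj; exists i, j.
Qed.

Lemma weight_pad_mx (n p q : nat) (A : 'M[bool]_(p, q)) :
  (p <= n)%N -> (q <= n)%N -> (weight A <= weight (pad_mx n A))%N.
Proof.
move=> pn qn.
pose h (ij : 'I_p * 'I_q) := (widen_ord pn ij.1, widen_ord qn ij.2).
have h_inj : injective h.
  by move=> [i j] [i' j'] [] /val_inj -> /val_inj ->.
rewrite /weight -(fintype.card_image h_inj).
apply/subset_leq_card/fintype.subsetP => _ /fintype.imageP[[i j] Aij ->].
by rewrite inE; apply/pad_mxP; exists i, j.
Qed.

Lemma Amx_enum_rank d m (x : Arow d m) (y : Acol d m) :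
  Amx d m (Order.enum_rank x) (Order.enum_rank y) = Aentry x y.
Proof. by rewrite mxE !Order.EnumVal.enum_rankK. Qed.

Lemma lt_enum_val (disp : Order.disp_t) (T : finOrderType disp) (i j : 'I_#|T|) :
  (i < j)%N -> (Order.enum_val i < Order.enum_val j :> T)%O.
Proof.
by rewrite (leW_mono (@Order.EnumVal.le_enum_val _ T (@le_total _ T) T)).
Qed.

Section Freeness.
Variables (R : realType) (a b : nat) (M : 'M[bool]_(a, b)).
Hypothesis hM : covering_pattern R M.

Lemma pfree_Amx d m : pfree (Amx d m) M.
Proof.
have [_ [k kP]] := hM; move=> [f [g [fmono gmono fgA]]].
apply: (@covering_row_not_embedded R a b M k d m
  (fun i => Order.enum_val (f i)) (fun j => Order.enum_val (g j))) => //.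
- by move=> i i' _ _ _ _ /fmono; apply: lt_enum_val.
- by move=> j j' /gmono; apply: lt_enum_val.
- by move=> i j /fgA; rewrite mxE.
Qed.

(* The pattern may have empty rows, which can be placed in the zero rows of the
   padding.  Empty columns cannot, since the last column is nonempty. *)
Lemma pfree_pad_Amx n d m : pfree (pad_mx n (Amx d m)) M.
Proof.
have [_ [k kP]] := hM; move=> [f [g [fmono gmono fgA]]].
have [_ [j1 j1E Mk1] _ _ _] := kP.
(* [x0] serves as default for the pattern rows sent into the padding. *)
have [x0 [_ _]] := pad_mxP _ _ _ (fgA _ _ Mk1).
have lt_g j : (g j < #|{: Acol d m}|)%N.
  have [x [y [_ gy _]]] := pad_mxP _ _ _ (fgA _ _ Mk1).
  apply: leq_ltn_trans (ltn_ord y); rewrite -gy.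
  have : (j <= j1)%N by have := ltn_ord j; lia.
  by rewrite leq_eqVlt => /predU1P[/val_inj->|/gmono/ltnW].
apply: (@covering_row_not_embedded R a b M k d m
  (fun i => Order.enum_val (insubd x0 (val (f i))))
  (fun j => Order.enum_val (Ordinal (lt_g j)))) => //.
- move=> i i' j j' /fgA/pad_mxP[x [y [fx _ _]]] /fgA/pad_mxP[x' [y' [fx' _ _]]].
  by move=> /fmono; rewrite /= fx fx' !valKd; apply: lt_enum_val.
- move=> j j' /gmono jj'.
  exact: (@lt_enum_val _ (Acol d m) (Ordinal (lt_g j)) (Ordinal (lt_g j'))).
- move=> i j /fgA/pad_mxP[x [y [fx gy]]].
  rewrite mxE /= fx valKd; congr (Aentry _ (Order.enum_val _)).
  exact: val_inj.
Qed.

Lemma weight_Amx_le_Ex n d m :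
  (#|{: Arow d m}| <= n)%N -> (#|{: Acol d m}| <= n)%N ->
  (weight (Amx d m) <= Ex M n)%N.
Proof.
move=> rn cn; apply: leq_trans (weight_pad_mx _ rn cn) _.
by apply: (leq_bigmax_cond (F := @weight n n)); apply/asboolP/pfree_pad_Amx.
Qed.

End Freeness.

(** * Counting the ones of [A] *)

Lemma card_Arow d m : #|{: Arow d m}| = (m ^ d.+1)%N.
Proof. by rewrite card_prod card_tuple !card_ord expnS. Qed.

Lemma card_Acol d m : #|{: Acol d m}| = (2 ^ d * m ^ d)%N.
Proof. by rewrite card_prod !card_tuple card_ord card_bool mulnC. Qed.

(** With slopes at most [q] and coordinates of [c] at most [m - q], the vector [c + s i] never
    leaves the range, so every triple [(s, c, i)] yields a one. *)
Lemma weight_Amx_ge d m q : (q <= m)%N ->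
  (q * (m - q) ^ d * 2 ^ d <= weight (Amx d m))%N.
Proof.
move=> qm.
pose D := ('I_q * d.-tuple 'I_(m - q) * d.-tuple bool)%type.
have cardD : #|{: D}| = (q * (m - q) ^ d * 2 ^ d)%N.
  by rewrite !card_prod !card_tuple !card_ord card_bool.
pose col (u : D) : Acol d m := (map_tuple (widen_ord (leq_subr q m)) u.1.2, u.2).
pose row (u : D) : Arow d m := (widen_ord qm u.1.1,
  [tuple insubd (widen_ord qm u.1.1) (tnth u.1.2 k + u.1.1.+1 * tnth u.2 k)%N | k < d]).
pose h u := (Order.enum_rank (row u), Order.enum_rank (col u)).
have h_inj : injective h.
  move=> [[s c] i] [[s' c'] i'] [].
  move=> /(can_inj (@Order.EnumVal.enum_rankK _ _)) [/val_inj/= -> _].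
  move=> /(can_inj (@Order.EnumVal.enum_rankK _ _)) [cc ->].
  congr (_, _, _); apply/val_inj; apply: (@inj_map _ _ (widen_ord (leq_subr q m))) => //.
  by move=> x y [/val_inj].
rewrite -cardD -(fintype.card_image h_inj); apply/subset_leq_card/fintype.subsetP.
move=> _ /fintype.imageP[[[s c] i] _ ->]; rewrite inE Amx_enum_rank /=.
apply/forallP => k /=; rewrite tnth_mktuple tnth_map val_insubd /= ifT //.
by have := ltn_ord (tnth c k); have := ltn_ord s; case: (tnth i k) => /=; lia.
Qed.

(** A mean value estimate for powers; it shows below that small changes of the base cost at most a
    factor 2. *)
Lemma leq_expSD x e k : ((x + e) ^ k.+1 <= x ^ k.+1 + k.+1 * e * (x + e) ^ k)%N.
Proof.
elim: k => [|k IH]; first by rewrite !expn1 mul1n muln1.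
rewrite expnS mulnDl [(x ^ k.+2)%N]expnS.
have := leq_mul (leqnn x) IH; rewrite mulnDr => {}IH.
apply: leq_trans (leq_add IH (leqnn _)) _.
have := leq_mul (leqnn (k.+1 * e * (x + e) ^ k)) (leq_addr e x).
rewrite [((x + e) ^ k.+1)%N]expnS; nia.
Qed.

(** The 8 is 4 times 2: rounding [q] down gives [m <= 4 * d * q], and [2 * d * q <= m] keeps
    [(m - q) ^ d] at least half of [m ^ d]. *)
Lemma weight_Amx_lower d m : (0 < d)%N -> (2 * d <= m)%N ->
  (m ^ d.+1 * 2 ^ d <= 8 * d * weight (Amx d m))%N.
Proof.
case: d => // k _ dm; set q := (m %/ (2 * k.+1))%N.
have mq : (m <= 4 * k.+1 * q)%N.
  have q_gt0 : (0 < q)%N by rewrite divn_gt0.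
  have := ltn_ceil m (isT : 0 < 2 * k.+1)%N; rewrite -/q; nia.
have qm : (2 * k.+1 * q <= m)%N by rewrite mulnC leq_divM.
have q_le : (q <= m)%N by nia.
have half : (m ^ k.+1 <= 2 * (m - q) ^ k.+1)%N.
  have := leq_expSD (m - q) q k; rewrite subnK //.
  have : (2 * k.+1 * q * m ^ k <= m ^ k.+1)%N by rewrite expnS leq_mul2r qm orbT.
  by set u := (m ^ k.+1)%N; set v := ((m - q) ^ k.+1)%N; set w := (m ^ k)%N; nia.
apply: leq_trans _ (leq_mul (leqnn (8 * k.+1)) (weight_Amx_ge k.+1 q_le)).
rewrite [(m ^ _)%N]expnS.
have := leq_mul mq half; set u := (m ^ _)%N; set v := ((m - q) ^ _)%N => H.
by rewrite !mulnA leq_mul2r; apply/orP; right; move: H; lia.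
Qed.

(** * Choice of [d] and [m] *)

Lemma leq_doubleS_exp2 d : (2 < d)%N -> (2 * d.+1 <= 2 ^ d)%N.
Proof.
elim: d => // d IH; rewrite leq_eqVlt => /predU1P[<-//|/IH].
by rewrite expnS; lia.
Qed.

Lemma exists_Amx_parameters n d0 : (2 < d0)%N -> (2 ^ (d0 * d0.+1) <= n)%N ->
  exists d m, [/\ (d0 <= d)%N, (2 ^ d <= m)%N,
    (2 ^ (d * d.+1) <= n < 2 ^ (d.+1 * d.+2))%N
  & (m ^ d.+1 <= n <= 2 * m ^ d.+1)%N].
Proof.
move=> d0_gt2 n_ge.
have ub_d i : (2 ^ (i * i.+1) <= n)%N -> (i <= n)%N.
  move=> h; apply: leq_trans h; apply/ltnW/(leq_ltn_trans _ (ltn_expl _ _)) => //.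
  by rewrite leq_pmulr.
case: (@ex_maxnP (fun d => 2 ^ (d * d.+1) <= n)%N n (ex_intro _ d0 n_ge) ub_d) => d d_le max_d.
have d0d : (d0 <= d)%N by apply: max_d.
have ub_m i : (i ^ d.+1 <= n)%N -> (i <= n)%N.
  by move=> h; apply: leq_trans h; case: i => // i; apply: leq_pexp2l (_ : 0 < d.+1)%N.
have ex_m : exists m, (m ^ d.+1 <= n)%N by exists (2 ^ d)%N; rewrite -expnM.
case: (ex_maxnP ex_m ub_m) => m m_le max_m.
have dm : (2 ^ d <= m)%N by apply: max_m; rewrite -expnM.
exists d, m; split=> //; rewrite ?d_le ?m_le /=.
  by rewrite ltnNge; apply/negP => /max_d; rewrite ltnn.
have n_lt : (n < m.+1 ^ d.+1)%N.
  by rewrite ltnNge; apply/negP => /max_m; rewrite ltnn.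
(* This makes [m.+1 ^ d.+1] at most twice [m ^ d.+1]. *)
have md : (2 * d.+1 <= m.+1)%N.
  apply: leq_trans (leq_trans dm (leqnSn _)).
  exact: leq_doubleS_exp2 (leq_trans d0_gt2 d0d).
have := leq_expSD m 1 d; rewrite addn1 muln1.
have : (2 * d.+1 * m.+1 ^ d <= m.+1 ^ d.+1)%N by rewrite expnS leq_mul2r md orbT.
move: n_lt; set u := (m.+1 ^ d.+1)%N; set v := (m ^ d.+1)%N; set w := (m.+1 ^ d)%N.
nia.
Qed.

(** The factor [16 * d] combines [8 * d] from the weight with 2 from [n <= 2 * m ^ d.+1]. *)
Lemma Ex_lower_nat (R : realType) (a b : nat) (M : 'M[bool]_(a, b)) (n d0 : nat) :
  covering_pattern R M -> (2 < d0)%N -> (2 ^ (d0 * d0.+1) <= n)%N ->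
  exists2 d, (d0 <= d)%N & (2 ^ (d * d.+1) <= n < 2 ^ (d.+1 * d.+2))%N /\
    (n * 2 ^ d <= 16 * d * Ex M n)%N.
Proof.
move=> hM d0_gt2 n_ge.
have [d [m [d0d dm nd /andP[mn nm]]]] := exists_Amx_parameters d0_gt2 n_ge.
exists d => //; split=> //.
have d_gt2 := leq_trans d0_gt2 d0d.
have rn : (#|{: Arow d m}| <= n)%N by rewrite card_Arow.
have cn : (#|{: Acol d m}| <= n)%N.
  by rewrite card_Acol; apply: leq_trans mn; rewrite expnS leq_mul2r dm orbT.
have md : (2 * d <= m)%N.
  by have := leq_trans (leq_doubleS_exp2 d_gt2) dm; lia.
have := leq_mul (leqnn (2 * (8 * d))) (weight_Amx_le_Ex hM rn cn).
have := weight_Amx_lower (ltnW (ltnW d_gt2)) md.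
have := leq_mul nm (leqnn (2 ^ d)).
set u := (m ^ d.+1)%N; set v := (2 ^ d)%N; set w := weight _; nia.
Qed.

(** * Binary logarithms and the asymptotic bound *)

Section Log2.
Variable R : realType.

Let ln2_gt0 : 0 < ln 2 :> R. Proof. by rewrite ln_gt0 // ltr1n. Qed.

Lemma powR2_log2 (x : R) : 0 < x -> 2 `^ log2 x = x.
Proof.
move=> x_gt0; rewrite /powR pnatr_eq0 /= /log2 divfK ?lnK //.
by rewrite gt_eqF.
Qed.

Lemma log2_exp2 k : log2 (2 ^+ k) = k%:R :> R.
Proof. by rewrite /log2 lnXn // -[ln 2 *+ k]mulr_natl mulfK // gt_eqF. Qed.

Lemma ler_log2 (x y : R) : 0 < x -> x <= y -> log2 x <= log2 y.
Proof.
move=> x_gt0 xy; rewrite /log2 ler_pM2r ?invr_gt0 // ler_ln // posrE //.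
exact: lt_le_trans xy.
Qed.

End Log2.

(** Both exponents are rounded outwards to squares, ready for the square root. *)
Lemma log2_natr_bounds (R : realType) (n d : nat) :
  (2 ^ (d * d.+1) <= n < 2 ^ (d.+1 * d.+2))%N ->
  d%:R ^+ 2 <= log2 (n%:R : R) <= d.+2%:R ^+ 2.
Proof.
move=> /andP[lo hi].
have n_gt0 : 0 < n%:R :> R by rewrite ltr0n; apply: leq_trans lo; rewrite expn_gt0.
rewrite -!natrX -(log2_exp2 R (d ^ 2)) -(log2_exp2 R (d.+2 ^ 2)) -!natrX.
apply/andP; split; apply: ler_log2; rewrite ?n_gt0 ?ltr0n ?expn_gt0 ?ler_nat //.
  by apply: leq_trans lo; rewrite leq_exp2l //; lia.
by apply: leq_trans (ltnW hi) _; rewrite leq_exp2l //; lia.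
Qed.

Unset Implicit Arguments.

Theorem theorem2p1 (R : realType) (alpha beta : nat)
    (M : 'M[bool]_(alpha, beta)) (hM : covering_pattern R M) :
  (forall b m : nat, (0 < b)%N -> (0 < m)%N -> pfree (Amx b m) M) /\
  (exists2 h : nat -> R,
     h =O_\oo (fun n : nat => log2 (log2 (n%:R : R))) &
     \forall n \near \oo,
       n%:R * 2 `^ (Num.sqrt (log2 (n%:R : R)) - h n) <= (Ex M n)%:R :> R).
Proof.
split; first by move=> b m _ _; apply: (pfree_Amx hM).
exists (fun n => log2 (log2 (n%:R : R))).
  by apply/eqO_exP; exists 1 => //; apply: nearW => n; rewrite mul1r.
(* 64 is 4 times 16: [2 ^+ d.+2] is [4 * 2 ^+ d], which costs [64 * d], and [d >= 64] bounds this by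
   [d ^ 2], hence by [L]. *)
pose d0 := 64%N; pose N := (2 ^ (d0 * d0.+1))%N.
exists N => //= n Nn.
have [d d0d [nd Ed]] := Ex_lower_nat hM (isT : (2 < d0)%N) Nn.
have d_gt0 : 0 < d%:R :> R by rewrite ltr0n; apply: leq_trans d0d.
have /andP[L_ge L_le] := log2_natr_bounds R nd.
set L := log2 _ in L_ge L_le *.
have L_gt0 : 0 < L by apply: lt_le_trans L_ge; rewrite exprn_gt0.
have S_le : Num.sqrt L <= d.+2%:R.
  by rewrite -[leRHS]ger0_norm // -sqrtr_sqr ler_wsqrtr.
(* Subtracting [log2 L] in the exponent is division by [L]. *)
rewrite powRB ?pnatr_eq0 ?implybT // powR2_log2 // mulrA ler_pdivrMr //.
have powS : 2 `^ Num.sqrt L <= 2 ^+ d.+2 :> R.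
  by rewrite -powR_mulrn // ler_powR // ler1n.
have EdR : n%:R * 2 ^+ d <= 16 * d%:R * (Ex M n)%:R :> R.
  by rewrite -natrX -!natrM ler_nat.
have d64 : 64 <= d%:R :> R by rewrite ler_nat.
apply: le_trans (ler_wpM2l (ler0n _ _) powS) _.
apply: le_trans (ler_wpM2l (ler0n _ _) L_ge).
have dE : 64 * (d%:R * (Ex M n)%:R) <= d%:R * (d%:R * (Ex M n)%:R) :> R.
  by rewrite ler_wpM2r // mulr_ge0.
rewrite !exprS expr0 mulr1; lra.
Qed.
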